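(* Let $d\ge1$ and let $\Upsilon,\Xi\subset\mathbb{R}^d$ be (nonempty) open, bounded and connected sets. (i) If $\Omega=\Xi+\Upsilon$ and $f$ is a continuous function on the closure of $\Omega$, then $$\operatorname{Rank}\Gamma_f=\lim_{l\to0^+}\operatorname{Rank}\boldsymbol{\Gamma}_{f,l}.$$ (ii) If $\Omega=\Xi-\Upsilon$ and $f$ is a continuous function on the closure of $\Omega$, then $$\operatorname{Rank}\Theta_f=\lim_{l\to0^+}\operatorname{Rank}\boldsymbol{\Theta}_{f,l}.$$
   Context: Here $\Xi\pm\Upsilon=\{x\pm y:x\in\Xi,y\in\Upsilon\}$. The truncated correlation operator $\Gamma_f:L^2(\Upsilon)\to L^2(\Xi)$ (for $f$ on $\Xi+\Upsilon$) and the truncated convolution operator $\Theta_f:L^2(\Upsilon)\to L^2(\Xi)$ (for $f$ on $\Xi-\Upsilon$) are $$\Gamma_f(g)(x)=\int_\Upsilon f(x+y)g(y)\,dy,\qquad \Theta_f(g)(x)=\int_\Upsilon f(x-y)g(y)\,dy,\qquad x\in\Xi.$$ For a sampling length $l>0$ let $\boldsymbol{\Upsilon}_l=\{\boldsymbol{n}l\in\Upsilon:\boldsymbol{n}\in\mathbb{Z}^d\}$ and $\boldsymbol{\Xi}_l=\{\boldsymbol{n}l\in\Xi:\boldsymbol{n}\in\mathbb{Z}^d\}$. The discretized operators $\boldsymbol{\Gamma}_{f,l},\boldsymbol{\Theta}_{f,l}$ map complex functions on $\boldsymbol{\Upsilon}_l$ to complex functions on $\boldsymbol{\Xi}_l$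 by $$\boldsymbol{\Gamma}_{f,l}(g)(\boldsymbol{x})=\sum_{\boldsymbol{y}\in\boldsymbol{\Upsilon}_l}f(\boldsymbol{x}+\boldsymbol{y})g(\boldsymbol{y}),\qquad \boldsymbol{\Theta}_{f,l}(g)(\boldsymbol{x})=\sum_{\boldsymbol{y}\in\boldsymbol{\Upsilon}_l}f(\boldsymbol{x}-\boldsymbol{y})g(\boldsymbol{y}),\qquad\boldsymbol{x}\in\boldsymbol{\Xi}_l.$$ The rank of an operator is the dimension of its range, a value in $\{0,1,2,\ldots\}\cup\{\infty\}$; limits are taken in the extended sense. *)

(* Defs.v *)
From HB Require Import structures.
From mathcomp Require Import all_boot all_order all_algebra.
From mathcomp Require Import generic_quotient ring_quotient complex.
From mathcomp Require Import all_classical all_reals all_analysis.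
From mathcomp Require Import measurable_realfun ring.

Set Implicit Arguments.
Unset Strict Implicit.
Unset Printing Implicit Defensive.

Import Order.TTheory GRing.Theory Num.Theory.
Import numFieldNormedType.Exports.

Local Open Scope classical_set_scope.
Local Open Scope ring_scope.
Local Open Scope complex_scope.
Local Open Scope quotient_scope.

(* The Borel sigma-algebra of R^n, generated by the coordinates (this is how
   the library equips n.-tuple R). *)
Section measurable_rV.
Variables (R : realType) (n : nat).

Let coord (i : 'I_n) (x : 'rV[R]_n) : measurableTypeR R := x ord0 i.

Let rV_set0 : g_sigma_preimage coord set0.
Proof. exact: sigma_algebra0. Qed.

Let rV_setC A : g_sigma_preimage coord A -> g_sigma_preimage coord (~` A).
Proof. exact: sigma_algebraC. Qed.

Let rV_bigcup (F : _^nat) : (forall i, g_sigma_preimage coord (F i)) ->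
  g_sigma_preimage coord (\bigcup_i (F i)).
Proof. exact: sigma_algebra_bigcup. Qed.

HB.instance Definition _ := @isMeasurable.Build default_measure_display
  'rV[R]_n (g_sigma_preimage coord) rV_set0 rV_setC rV_bigcup.

Lemma measurable_coord (i : 'I_n) :
  measurable_fun setT (fun x : 'rV[R]_n => x ord0 i : measurableTypeR R).
Proof.
move=> _ Y mY; rewrite setTI; apply: sub_sigma_algebra => /=.
rewrite -bigcup_seq/=; exists i => /=; first by rewrite mem_index_enum.
by exists Y => //; rewrite setTI.
Qed.

Lemma measurable_fun_rV d (T : measurableType d) (f : T -> 'rV[R]_n) :
  (forall i, measurable_fun setT (fun x => f x ord0 i : measurableTypeR R)) ->
  measurable_fun setT f.
Proof.
move=> mf _ B mB; rewrite setTI; move: B mB.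
suff : @measurable _ 'rV[R]_n `<=` [set B | measurable (f @^-1` B)] by [].
apply: smallest_sub; last first.
  move=> B; rewrite -bigcup_seq/= => -[i _ [C mC <-]] /=.
  by rewrite setTI -[X in measurable X]setTI; exact: mf.
split => /=.
- by rewrite preimage_set0.
- by move=> B mB; rewrite setTD preimage_setC; exact: measurableC.
- by move=> F mF; rewrite preimage_bigcup; exact: bigcup_measurable.
Qed.

Lemma open_measurable_rV (A : set 'rV[R]_n) : open A -> measurable A.
Proof.
move=> oA.
pose B (p : 'rV[rat]_n * nat) : set 'rV[R]_n :=
  ball (map_mx ratr p.1 : 'rV[R]_n) (p.2.+1%:R^-1 : R).
have mB p : measurable (B p).
  rewrite /B (_ : ball _ _ = \bigcap_(i in [set: 'I_n])
      [set x : 'rV[R]_n | ball (ratr (p.1 ord0 i) : R) p.2.+1%:R^-1 (x ord0 i)]).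
    apply: fin_bigcap_measurable => // i _.
    rewrite -[X in measurable X]setTI; apply: (measurable_coord i) => //.
    exact: measurable_ball.
  apply/seteqP; split => [x [_ px] i _|x px].
    by have := px ord0 i; rewrite mxE.
  split=> [|j i]; first by rewrite invr_gt0.
  by rewrite (ord1 j) mxE; exact: px.
rewrite (_ : A = \bigcup_p (if `[< B p `<=` A >] then B p else set0)).
  apply: countable_bigcupT_measurable => [|p]; first exact: countableP.
  by case: ifPn.
apply/seteqP; split => [x Ax|x [p _]]; last by case: asboolP => [BA /BA//|_ []].
have /nbhs_ballP[e /= e0 xA] : nbhs x A by exact: open_nbhs_nbhs.
have [k ke] : exists k : nat, k.+1%:R^-1 < e / 2 :> R.
  have [k _ /(_ k (leqnn k))] :=
    near_infty_natSinv_lt (PosNum (divr_gt0 e0 (ltr0n R 2))).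
  by exists k.
have k0 : 0 < k.+1%:R^-1 :> R by rewrite invr_gt0.
have /choice[q qx] (i : 'I_n) : exists q : rat, `|x ord0 i - ratr q| < k.+1%:R^-1.
  have /rat_in_itvoo[q /itvP xq] : x ord0 i - k.+1%:R^-1 < x ord0 i by rewrite ltrBlDr ltrDl.
  exists q; rewrite ltr_distlC xq/=.
  by apply: (@lt_trans _ _ (x ord0 i)); rewrite ?xq// ltrDl.
exists (\row_i q i, k) => //.
have xB : B (\row_i q i, k) x.
  split=> // j i; rewrite !mxE (ord1 j) /ball/= distrC; exact: qx.
case: asboolP => // -[] y [_ yB]; apply: xA; split => // j i.
have := yB j i; have := xB.2 j i.
rewrite /ball/= => h1 h2.
rewrite (splitr e) -(subrK (map_mx ratr (\row_i q i) j i) (x j i)) -addrA.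
apply: (le_lt_trans (ler_normD _ _)); apply: ltrD; last exact: lt_trans ke.
by rewrite distrC; exact: lt_trans ke.
Qed.

End measurable_rV.

Section lebesgue_rV.
Variable R : realType.

Definition consr n (p : 'rV[R]_n * measurableTypeR R) : 'rV[R]_n.+1 :=
  row_mx (p.2%:M : 'rV[R]_1) p.1.

Lemma measurable_consr n : measurable_fun setT (@consr n).
Proof.
apply: measurable_fun_rV => i; rewrite /consr.
have -> : (fun p : 'rV[R]_n * measurableTypeR R =>
    (row_mx (p.2%:M : 'rV[R]_1) p.1 : 'rV[R]_(1 + n)) ord0 i) =
  match fintype.split (i : 'I_(1 + n)) with
  | inl _ => fun p => p.2
  | inr j => (fun x : 'rV[R]_n => x ord0 j : measurableTypeR R) \o fst
  end.
  apply/funext => p; rewrite mxE; case: fintype.split => j //=.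
  by rewrite mxE !ord1 /= mulr1n.
case: fintype.split => j; first exact: measurable_snd.
exact: (measurableT_comp (measurable_coord j) measurable_fst).
Qed.

Section lebesgue_rVS.
Variables (n : nat) (mu : {measure set 'rV[R]_n -> \bar R}).

Definition lebesgue_rVS : set 'rV[R]_n.+1 -> \bar R :=
  pushforward (mu \x @lebesgue_measure R)%E (@consr n).

Let mconsr := @measurable_consr n.

Let lebesgue_rVS0 : lebesgue_rVS set0 = 0%E.
Proof. exact: measure0. Qed.

Let lebesgue_rVS_ge0 A : (0 <= lebesgue_rVS A)%E.
Proof. exact: measure_ge0. Qed.

Let lebesgue_rVS_sigma_additive : semi_sigma_additive lebesgue_rVS.
Proof. exact: measure_semi_sigma_additive. Qed.

HB.instance Definition _ := isMeasure.Build _ _ _ lebesgue_rVS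
  lebesgue_rVS0 lebesgue_rVS_ge0 lebesgue_rVS_sigma_additive.

End lebesgue_rVS.

(* lebesgue_rV n.+1 is the product of lebesgue_rV n with lebesgue_measure,
   transported along R^n * R = R^n.+1 *)
Fixpoint lebesgue_rV n : {measure set 'rV[R]_n -> \bar R} :=
  if n is m.+1 then lebesgue_rVS (lebesgue_rV m) else \d_(0 : 'rV[R]_0).

End lebesgue_rV.

(* The complex space L^2(D, mu): functions whose real and imaginary parts are
   measurable on D with |g|^2 integrable over D, modulo equality mu-almost
   everywhere on D. As for measurable_fun, the condition on g is only
   meaningful for measurable D (open sets are, see open_measurable_rV); the
   values of g outside D are irrelevant. *)
Section L2.
Context d (T : measurableType d) (R : realType).
Variables (mu : {measure set T -> \bar R}) (D : set T).

Definition square_integrable (g : T -> R[i]^o) : Prop := measurable D ->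
  [/\ measurable_fun D (fun x => complex.Re (g x)),
      measurable_fun D (fun x => complex.Im (g x)) &
      (\int[mu]_(x in D) (Normc.normc (g x) ^+ 2)%:E < +oo)%E].

Definition L2pred : {pred T -> R[i]^o} := mem [set g | square_integrable g].

Let normc2 (z : R[i]) :
  Normc.normc z ^+ 2 = complex.Re z ^+ 2 + complex.Im z ^+ 2.
Proof.
by case: z => a b /=; rewrite sqr_sqrtr// addr_ge0// sqr_ge0.
Qed.

Let measurable_normc2 (g : T -> R[i]^o) :
  measurable_fun D (fun x => complex.Re (g x)) ->
  measurable_fun D (fun x => complex.Im (g x)) ->
  measurable_fun D (fun x => (Normc.normc (g x) ^+ 2)%:E).
Proof.
move=> mr mi; apply/measurable_EFinP.
under eq_fun do rewrite normc2.
by apply: measurable_funD; exact: measurable_funX.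
Qed.

Lemma L2pred_submod : submod_closed L2pred.
Proof.
split.
  rewrite inE => mD; split; [exact: measurable_cst|exact: measurable_cst|].
  by rewrite integral0_eq// => x _; rewrite normc2 /= expr0n /= addr0.
move=> a g h; rewrite !inE => + + mD.
move=> /(_ mD)[gr gi gf] /(_ mD)[hr hi hf].
have er : (fun x => complex.Re ((a *: g + h) x)) =
    (fun x => complex.Re a * complex.Re (g x) - complex.Im a * complex.Im (g x)
      + complex.Re (h x)).
  apply/funext => x; rewrite [(_ + h) x]/(a * g x + h x).
  by move: (a) (g x) (h x) => [? ?] [? ?] [? ?].
have ei : (fun x => complex.Im ((a *: g + h) x)) =
    (fun x => complex.Re a * complex.Im (g x) + complex.Im a * complex.Re (g x)
      + complex.Im (h x)).
  apply/funext => x; rewrite [(_ + h) x]/(a * g x + h x).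
  by move: (a) (g x) (h x) => [? ?] [? ?] [? ?].
have mr : measurable_fun D (fun x => complex.Re ((a *: g + h) x)).
  rewrite er; apply: measurable_funD => //; apply: measurable_funB;
    exact: measurable_funM.
have mi : measurable_fun D (fun x => complex.Im ((a *: g + h) x)).
  rewrite ei; apply: measurable_funD => //; apply: measurable_funD;
    exact: measurable_funM.
split => //.
pose c : R := 2 * Normc.normc a ^+ 2.
have c0 : 0 <= c by rewrite mulr_ge0// sqr_ge0.
pose b x : \bar R := (c%:E * (Normc.normc (g x) ^+ 2)%:E
    + 2%:E * (Normc.normc (h x) ^+ 2)%:E)%E.
have n0 (k : T -> R[i]^o) x : D x -> (0 <= (Normc.normc (k x) ^+ 2)%:E)%E.
  by rewrite lee_fin sqr_ge0.
have mb (k : R) (u : T -> \bar R) :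
  measurable_fun D u -> measurable_fun D (fun x => k%:E * u x)%E.
  by move=> mu'; exact: measurable_funeM.
have mg := measurable_normc2 gr gi.
have mh := measurable_normc2 hr hi.
apply: (@le_lt_trans _ _ (\int[mu]_(x in D) b x)%E).
  apply: ge0_le_integral => //.
  - exact: n0.
  - exact: measurable_normc2.
  - by apply: emeasurable_funD; exact: mb.
  - move=> x _; rewrite /b /c -!EFinM -EFinD lee_fin !normc2.
    rewrite [(_ + h) x]/(a * g x + h x).
    move: (a) (g x) (h x) => [a1 a2] [g1 g2] [h1 h2] /=.
    rewrite -subr_ge0; set z := (X in 0 <= X).
    have -> : z = (a1 * g1 - a2 * g2 - h1) ^+ 2 + (a1 * g2 + a2 * g1 - h2) ^+ 2.
      by rewrite /z; ring.
    by rewrite addr_ge0// sqr_ge0.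
rewrite ge0_integralD//; last 4 first.
- by move=> x Dx; rewrite mule_ge0// ?lee_fin// sqr_ge0.
- exact: mb.
- by move=> x Dx; rewrite mule_ge0// ?lee_fin// sqr_ge0.
- exact: mb.
rewrite !ge0_integralZl//; try exact: n0.
by rewrite lte_add_pinfty// lte_mul_pinfty// ?lee_fin.
Qed.

HB.instance Definition _ :=
  GRing.isSubmodClosed.Build _ _ L2pred L2pred_submod.

Record L2fun := MkL2fun { L2val :> T -> R[i]^o; _ : L2val \in L2pred }.

HB.instance Definition _ := [isSub for L2val].
HB.instance Definition _ := [Choice of L2fun by <:].
HB.instance Definition _ := [SubChoice_isSubLmodule of L2fun by <:].

Definition ae_null : {pred L2fun} :=
  mem [set g : L2fun | \forall x \ae mu, D x -> g x = 0].

Lemma ae_null_submod : submod_closed ae_null.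
Proof.
split; first by rewrite inE; apply: aeW.
move=> a g h; rewrite !inE => g0 h0; near=> x => Dx.
rewrite [LHS]/(a * g x + h x).
by rewrite (near g0 x)// (near h0 x)// mulr0; exact: (addr0 (0 : R[i])).
Unshelve. all: end_near. Qed.

HB.instance Definition _ :=
  GRing.isSubmodClosed.Build _ _ ae_null ae_null_submod.

Definition L2 : Type := Quotient.quot ae_null.

HB.instance Definition _ := Choice.on L2.
HB.instance Definition _ := GRing.Zmodule.on L2.
HB.instance Definition _ := EqQuotient.on L2.

Lemma pi_L2P (g h : L2fun) :
  \pi_L2 g = \pi_L2 h <-> \forall x \ae mu, D x -> g x = h x.
Proof.
have -> : (\pi_L2 g = \pi_L2 h) <-> g - h \in ae_null.
  by rewrite Quotient.idealrBE; split => /eqP.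
have subE x : L2val (g - h) x = L2val g x - L2val h x by [].
rewrite inE; split; apply: filterS => x /[swap] Dx /(_ Dx).
  by rewrite subE => /eqP; rewrite subr_eq0 => /eqP.
by rewrite subE => ->; rewrite subrr.
Qed.

Definition L2scale (a : R[i]) (u : L2) : L2 := \pi_L2 (a *: repr u).

Lemma pi_L2Z a g : \pi_L2 (a *: g) = L2scale a (\pi_L2 g).
Proof.
have scaleE (h : L2fun) x : L2val (a *: h) x = a * L2val h x by [].
apply/pi_L2P; have /pi_L2P : \pi_L2 (repr (\pi_L2 g)) = \pi_L2 g by rewrite reprK.
by apply: filterS => x /[apply] e; rewrite !scaleE e.
Qed.

Lemma pi_L2D g h : \pi_L2 (g + h) = \pi_L2 g + \pi_L2 h.
Proof. by rewrite piE. Qed.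

Fact L2scaleA a b u : L2scale a (L2scale b u) = L2scale (a * b) u.
Proof. by elim/quotW: u => u; rewrite -(pi_L2Z b) -!pi_L2Z scalerA. Qed.

Fact L2scale1 : left_id 1 L2scale.
Proof. by elim/quotW => u; rewrite -pi_L2Z scale1r. Qed.

Fact L2scaleDr : right_distributive L2scale +%R.
Proof.
move=> a; elim/quotW => u; elim/quotW => v.
by rewrite -pi_L2D -!pi_L2Z -pi_L2D scalerDr.
Qed.

Fact L2scaleDl u : {morph L2scale^~ u : a b / a + b}.
Proof. by move=> a b /=; elim/quotW: u => u; rewrite -!pi_L2Z -pi_L2D scalerDl. Qed.

HB.instance Definition _ := GRing.Zmodule_isLmodule.Build R[i] L2
  L2scaleA L2scale1 L2scaleDr L2scaleDl.

End L2.

Section rank.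
Variable R : realType.

Definition is_basis (V : lmodType R[i]) (W : set V) n (e : 'I_n -> V) :=
  [/\ forall i, W (e i),
      forall c : 'I_n -> R[i], \sum_i c i *: e i = 0 -> forall i, c i = 0 &
      forall w, W w -> exists c : 'I_n -> R[i], w = \sum_i c i *: e i].

(* Two finite bases have the same size, so the infimum below is over at most
   one value; it is +oo when there is no finite basis. *)
Definition dimension (V : lmodType R[i]) (W : set V) : \bar R :=
  ereal_inf [set n%:R%:E | n in [set n | exists e : 'I_n -> V, is_basis W e]].

Definition rank (U V : lmodType R[i]) (A : U -> V) : \bar R :=
  dimension (range A).

End rank.

Section operators.
Variables (R : realType) (d : nat).
Implicit Types (X Y : set 'rV[R]_d) (f : 'rV[R]_d -> R[i]^o).

Definition L2rV X := L2 (lebesgue_rV R d) X.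

Definition Cintegral Y (h : 'rV[R]_d -> R[i]^o) : R[i] :=
  (\int[lebesgue_rV R d]_(y in Y) complex.Re (h y)) +i*
  (\int[lebesgue_rV R d]_(y in Y) complex.Im (h y)).

(* The class of h in L^2(X). It defaults to 0 when h is not square-integrable
   on X; this does not happen in corr_op and conv_op below when X and Y are
   bounded and open and f is continuous on the closure of X + Y, resp. X - Y,
   since the image of g is then bounded and continuous on X. *)
Definition L2class X (h : 'rV[R]_d -> R[i]^o) : L2rV X :=
  \pi_(L2rV X) (insubd (0 : L2fun (lebesgue_rV R d) X) h).

Definition corr_op X Y f (g : L2rV Y) : L2rV X :=
  L2class X (fun x => Cintegral Y (fun y => f (x + y) * repr g y)).

Definition conv_op X Y f (g : L2rV Y) : L2rV X :=
  L2class X (fun x => Cintegral Y (fun y => f (x - y) * repr g y)).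

Definition grid (l : R) X : set 'rV[R]_d :=
  [set x | X x /\ exists n : 'rV[int]_d, x = l *: map_mx intr n].

(* The sums are over the finitely many points of grid l Y (for 0 < l and Y
   bounded); \sum_(y \in _) is 0 when the support is infinite. *)
Definition dcorr_op X Y f (l : R) (g : grid l Y -> R[i]^o) :
    grid l X -> R[i]^o :=
  fun x => \sum_(y \in [set: grid l Y]) f (val x + val y) * g y.

Definition dconv_op X Y f (l : R) (g : grid l Y -> R[i]^o) :
    grid l X -> R[i]^o :=
  fun x => \sum_(y \in [set: grid l Y]) f (val x - val y) * g y.

End operators.

Arguments corr_op {R d} X Y f g.
Arguments conv_op {R d} X Y f g.
Arguments dcorr_op {R d} X Y f l g.
Arguments dconv_op {R d} X Y f l g.

(* Main.v *)
Require Import Defs.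
From mathcomp Require Import all_boot all_order all_algebra.
From mathcomp Require Import generic_quotient complex.
From mathcomp Require Import all_classical all_reals all_analysis.
From mathcomp Require Import measurable_realfun lra zify.
Set Implicit Arguments.
Unset Strict Implicit.
Unset Printing Implicit Defensive.
Import Order.TTheory GRing.Theory Num.Theory.
Import numFieldNormedType.Exports.
Local Open Scope classical_set_scope.
Local Open Scope ring_scope.

(** Both the integral operators and their discretizations come from one kernel
    k x y = f (x + y), resp. f (x - y), which is bounded and uniformly
    continuous on X * Y because f is continuous on a compact set. Call
    [det (k (x_i) (y_j))], with [x_i] in X and [y_j] in Y, a minor of k on
    X * Y. The proof shows that every rank in the theorem is the supremum of the
    sizes of the nonzero minors of the kernel, on X * Y for the integral operator
    and on the two grids for the discretized one.

    Ranks are handled through [dimension_geP]: a dimension is at least n exactly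
    when the set contains n independent vectors. So two facts are needed for
    each operator.

    If k has no nonzero minor of size n, then the range contains no n
    independent vectors. Indeed a nonzero minor of maximal size r < n, bordered
    by one more row and column, vanishes, and its Schur complement writes k as
    the sum over j < r of k x (y_j) times a function of y ([separable_kernel]).
    Hence the range lies in the span of the r columns k _ (y_j).

    Conversely a nonzero minor of size n gives n independent vectors in the
    range. In the discrete case, the operator maps the unit mass at y_j to the
    column k _ (y_j), and evaluating at the x_i shows independence. In the
    integral case, the unit mass is replaced by a uniform density on a small cube
    around y_j, whose image is an average of nearby columns. An almost everywhere
    vanishing combination of these images vanishes at points as close as desired
    to the x_i, where the matrix of values is a small perturbation of the minor,
    hence is still invertible ([det_neq0_perturb]).

    Finally a minor on the grids is a minor on X * Y, and every point of an open
    set is approximated by grid points when l tends to 0, so a nonzero minor on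
    X * Y yields, by perturbation again, a nonzero minor on all fine enough grids.
    So the discretized ranks never exceed the rank of the integral operator and
    eventually reach each natural number below it ([cvg_dimension]). *)

Local Notation normc := Normc.normc.

(** * Dimension through independent families *)

Section dimension.
Variable R : realType.
Implicit Types V : lmodType R[i].

Definition independent V n (e : 'I_n -> V) : Prop :=
  forall c : 'I_n -> R[i], \sum_i c i *: e i = 0 -> forall i, c i = 0.

Definition indep_in V (W : set V) n : Prop :=
  exists e : 'I_n -> V, (forall i, W (e i)) /\ independent e.

Lemma independent_span_size V n r (e : 'I_n -> V) (v : 'I_r -> V)
    (C : 'I_n -> 'I_r -> R[i]) :
  (forall i, e i = \sum_j C i j *: v j) -> independent e -> (n <= r)%N.
Proof.
move=> eC ie; rewrite leqNgt; apply/negP => rn.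
pose M : 'M[R[i]]_(n, r) := \matrix_(i, j) C i j.
have : kermx M != 0.
  by rewrite -mxrank_eq0 mxrank_ker -lt0n subn_gt0 (leq_ltn_trans (rank_leq_col _)).
case/rowV0Pn => u /sub_kermxP uM u0.
suff uz : u = 0 by rewrite uz eqxx in u0.
apply/rowP => i; rewrite mxE; move: i; apply: (ie (fun i => u ord0 i)).
have -> : \sum_i u ord0 i *: e i = \sum_i \sum_j (u ord0 i * C i j) *: v j.
  apply: eq_bigr => i _; rewrite eC scaler_sumr.
  by apply: eq_bigr => j _; rewrite scalerA.
rewrite exchange_big/= big1// => j _.
rewrite -scaler_suml.
have -> : \sum_i u ord0 i * C i j = (u *m M) ord0 j.
  by rewrite mxE; apply: eq_bigr => i _; rewrite mxE.
by rewrite uM mxE scale0r.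
Qed.

(** For minors, r is the size of a nonzero minor whose borders all vanish; for
    independent families, the size of one that cannot be extended. *)
Lemma max_below (P : nat -> Prop) n :
  P 0%N -> ~ P n -> exists r, [/\ (r < n)%N, P r & ~ P r.+1].
Proof.
move=> P0; elim: n => // n IH nP.
have [Pn|/IH[r [rn Pr nPr]]] := pselect (P n); first by exists n.
by exists r; split => //; exact: ltnW.
Qed.

Lemma indep_in0 V (W : set V) : indep_in W 0.
Proof. by exists (fun=> 0); split=> [[]//|c _ []]. Qed.

(** Adjoining w to e creates a relation, in which w has a nonzero coefficient
    because e is independent. *)
Lemma maximal_independent_basis V (W : set V) r (e : 'I_r -> V) :
  (forall i, W (e i)) -> independent e -> ~ indep_in W r.+1 -> is_basis W e.
Proof.
move=> We ie max; split => // w Ww.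
apply: contrapT => nspan; apply: max.
pose e' i := oapp e w (unlift ord0 i).
exists e'; split=> [i|c].
  by rewrite /e'; case: unliftP => [j|] _ /=.
rewrite big_ord_recl /e' unlift_none /=.
under eq_bigr do rewrite liftK /=.
move=> c0; have cz : c ord0 = 0.
  apply: contrapT => /eqP cn0; apply: nspan.
  exists (fun i => - (c ord0)^-1 * c (lift ord0 i)).
  apply: (scalerI cn0); rewrite scaler_sumr.
  move/eqP: c0; rewrite addr_eq0 => /eqP ->; rewrite -sumrN.
  by apply: eq_bigr => i _; rewrite scalerA mulrA mulrN mulfV// mulN1r scaleNr.
move: c0; rewrite cz scale0r add0r => /ie c0 i.
by case: (unliftP ord0 i) => [j ->|->].
Qed.

(** The infimum that defines the dimension is reached: without n independent
    vectors in W, an independent family that cannot be extended inside W has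
    fewer than n elements and is a basis. *)
Lemma dimension_geP V (W : set V) n :
  (n%:R%:E <= dimension W)%E <-> indep_in W n.
Proof.
split=> [|[e [We ie]]]; last first.
  apply: le_ereal_inf_tmp => _ [m [b [_ _ span]] <-]; rewrite lee_fin ler_nat.
  have /choice[C eC] i : exists c : 'I_m -> R[i], e i = \sum_j c j *: b j.
    exact: span.
  exact: (independent_span_size eC).
apply: contraPP; move=> nWn.
have [r [rn indr max]] := @max_below (indep_in W) n (indep_in0 W) nWn.
have [e [We ie]] := indr.
apply/negP; rewrite -ltNge.
apply: (@le_lt_trans _ _ (r%:R%:E)); last by rewrite lte_fin ltr_nat.
apply: ereal_inf_lbound; exists r => //=; exists e.
exact: maximal_independent_basis.
Qed.

Lemma dimensionE V (W : set V) :
  (exists n : nat, dimension W = n%:R%:E) \/ dimension W = +oo%E.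
Proof.
have [[n [e be]]|nob] := pselect (exists n, exists e : 'I_n -> V, is_basis W e).
  left; exists n; apply/eqP; rewrite eq_le; apply/andP; split.
    by apply: ereal_inf_lbound; exists n => //=; exists e.
  by apply/dimension_geP; exists e; case: be.
right; rewrite /dimension (_ : [set _ | _ in _] = set0) ?ereal_inf0//.
by apply/seteqP; split=> // x [n /= [e be] _]; apply: nob; exists n, e.
Qed.

(** Dimensions only take values in the naturals and +oo, so they are compared
    through the sizes of independent families. *)
Lemma dimension_le V1 V2 (W1 : set V1) (W2 : set V2) :
  (forall n, indep_in W1 n -> indep_in W2 n) ->
  (dimension W1 <= dimension W2)%E.
Proof.
move=> W12; have [[n W1n]|W1oo] := dimensionE W1.
  by rewrite W1n; apply/dimension_geP/W12/dimension_geP; rewrite W1n.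
have [[n W2n]|->] := dimensionE W2; last exact: leey.
have /W12 /dimension_geP : indep_in W1 n.+1.
  by apply/dimension_geP; rewrite W1oo leey.
by rewrite W2n lee_fin ler_nat ltnn.
Qed.

(** The bound from above is uniform in n, but each lower bound n may need its
    own neighbourhood: this suffices whether the limit is finite or not. *)
Lemma cvg_dimension V0 (W0 : set V0) (V : R -> lmodType R[i])
    (W : forall l, set (V l)) (F : set_system R) {FF : Filter F} :
  (\forall l \near F, forall n, indep_in (W l) n -> indep_in W0 n) ->
  (forall n, indep_in W0 n -> \forall l \near F, indep_in (W l) n) ->
  dimension (W l) @[l --> F] --> dimension W0.
Proof.
move=> up lo.
have [[n W0n]|W0oo] := dimensionE W0; last first.
  rewrite W0oo; apply/cvgeyPge => A.
  have /lo : indep_in W0 (Num.Def.truncn A).+1.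
    by apply/dimension_geP; rewrite W0oo leey.
  apply: filterS => l /dimension_geP; apply: le_trans.
  rewrite lee_fin; apply/ltW/truncnS_gt.
have /lo lon : indep_in W0 n by apply/dimension_geP; rewrite W0n.
apply: (@cvg_trans _ (dimension W0 @[l --> F])); last exact: cvg_cst.
apply: near_eq_cvg; near=> l; apply/eqP; rewrite eq_le; apply/andP; split.
  by rewrite W0n; apply/dimension_geP; near: l.
apply: dimension_le; near: l; exact: up.
Unshelve. all: by end_near. Qed.

End dimension.

(** * Minors of a kernel *)

(** If u annihilates M, then u = u (A - M) A^-1, and this multiplies the sum of
    the moduli of u by less than 1 when the entries of A - M are small. *)
Lemma det_neq0_perturb (K : numFieldType) n (A : 'M[K]_n) : \det A != 0 ->
  exists2 e : K, 0 < e &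
    forall M : 'M[K]_n, (forall i j, `|M i j - A i j| <= e) -> \det M != 0.
Proof.
rewrite -unitfE -[_ \is a _]/(A \in unitmx) => Au.
pose S := \sum_i \sum_k `|invmx A k i|.
have S0 : 0 <= S by rewrite sumr_ge0// => i _; rewrite sumr_ge0.
exists (S + 1)^-1 => [|M MA]; first by rewrite invr_gt0 ltr_wpDl.
apply/negP => /det0P[u u0 uM].
pose s := \sum_i `|u ord0 i|.
have s0 : 0 < s.
  rewrite lt_def sumr_ge0// andbT; apply: contra u0 => /eqP sz.
  have s0 i : xpredT i -> 0 <= `|u ord0 i| by [].
  apply/eqP/rowP => i; rewrite mxE; apply/normr0_eq0.
  exact: (psumr_eq0P s0 sz).
have uE : u = u *m (A - M) *m invmx A by rewrite mulmxBr uM subr0 mulmxK.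
suff : s <= s * (S + 1)^-1 * S.
  apply/negP; rewrite -mulrA; apply/negP; rewrite ler_pMr// mulrC.
  by rewrite ler_pdivlMr ?ltr_wpDl// mul1r gerDl ler10.
rewrite {1}/s /S mulr_sumr; apply: ler_sum => i _.
rewrite [in X in X <= _]uE mxE mulr_sumr.
apply: le_trans (ler_norm_sum _ _ _) _; apply: ler_sum => k _.
rewrite normrM ler_wpM2r// mxE.
apply: le_trans (ler_norm_sum _ _ _) _; rewrite mulr_suml.
by apply: ler_sum => j _; rewrite normrM ler_wpM2l// !mxE distrC.
Qed.

Section minors.
Variables (F : fieldType) (T U : Type).
Implicit Types (k : T -> U -> F) (X : set T) (Y : set U) (n : nat).

(** The points x_i and y_j may be repeated, which only produces zero minors. *)
Definition has_minor k X Y n : Prop :=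
  exists (x : 'I_n -> T) (y : 'I_n -> U),
    [/\ forall i, X (x i), forall j, Y (y j) &
        \det (\matrix_(i, j) k (x i) (y j)) != 0].

Lemma has_minor0 k X Y : has_minor k X Y 0.
Proof.
have none (V : Type) : 'I_0 -> V by case.
exists (none T), (none U).
by split=> [[]//|[]//|]; rewrite det_mx00 oner_eq0.
Qed.

Lemma has_minorS k X X' Y Y' n : X `<=` X' -> Y `<=` Y' ->
  has_minor k X Y n -> has_minor k X' Y' n.
Proof.
move=> XX' YY' [x [y [Xx Yy dxy]]]; exists x, y.
by split => // i; [exact: XX'|exact: YY'].
Qed.

(** Schur complement formula, from a block elimination of c. *)
Lemma det_bordered r (A : 'M[F]_r) (b : 'cV[F]_r) (c : 'rV[F]_r) (d : 'M[F]_1) :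
  A \in unitmx ->
  \det (block_mx A b c d) = \det A * \det (d - c *m invmx A *m b).
Proof.
move=> Au.
have -> : block_mx A b c d = block_mx 1%:M 0 (c *m invmx A) 1%:M *m
    block_mx A b 0 (d - c *m invmx A *m b).
  by rewrite mulmx_block !mul1mx !mul0mx !addr0 mulmxKV// addrC subrK.
by rewrite det_mulmx det_lblock det_ublock !det1 !mul1r.
Qed.

(** Take a nonzero minor of maximal size: the minors that border it vanish, and
    the Schur complement expresses the kernel through its rows and columns. *)
Lemma separable_kernel k X Y n : ~ has_minor k X Y n ->
  exists (r : nat) (x : 'I_r -> T) (y : 'I_r -> U) (B : 'M[F]_r),
    [/\ (r < n)%N, forall i, X (x i), forall j, Y (y j) &
        forall s t, X s -> Y t ->
          k s t = \sum_j k s (y j) * \sum_i B j i * k (x i) t].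
Proof.
move=> nn.
have [r [rn xy max]] := @max_below (has_minor k X Y) n (has_minor0 k X Y) nn.
have [x [y [Xx Yy dxy]]] := xy.
pose A := \matrix_(i, j) k (x i) (y j).
have Au : A \in unitmx by rewrite unitmxE unitfE.
exists r, x, y, (invmx A); split => // s t Xs Yt.
(* The rows and columns of the bordered minor. *)
pose x' (i : 'I_(r + 1)) := if fintype.split i is inl j then x j else s.
pose y' (i : 'I_(r + 1)) := if fintype.split i is inl j then y j else t.
pose b : 'cV[F]_r := \col_i k (x i) t.
pose c : 'rV[F]_r := \row_j k s (y j).
have : \det (\matrix_(i, j) k (x' i) (y' j)) = 0.
  apply: contrapT => /eqP d0; apply: max; rewrite -addn1; exists x', y'.
  by split=> // i; rewrite /x' /y'; case: fintype.split.
have -> : \matrix_(i, j) k (x' i) (y' j) = block_mx A b c (k s t)%:M.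
  apply/matrixP => i j; rewrite !mxE /x' /y'.
  by case: (fintype.split i) => i0; rewrite !mxE; case: (fintype.split j) => j0;
    rewrite ?mxE ?ord1 ?eqxx.
rewrite det_bordered// => /eqP; rewrite mulf_eq0 (negPf dxy)/= det_mx11.
rewrite !mxE eqxx mulr1n subr_eq0 => /eqP ->.
have E i : (c *m invmx A) ord0 i * b i ord0 =
    \sum_j k s (y j) * (invmx A j i * k (x i) t).
  by rewrite !mxE mulr_suml; apply: eq_bigr => j _; rewrite !mxE mulrA.
rewrite (eq_bigr _ (fun i _ => E i)) exchange_big/=.
by apply: eq_bigr => j _; rewrite mulr_sumr.
Qed.

End minors.

Section normc.
Local Open Scope complex_scope.
Variable R : realType.
Implicit Types z : R[i].

Lemma normr_normc z : `|z| = (normc z)%:C. Proof. by []. Qed.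

Lemma normc_ge0 z : 0 <= normc z.
Proof. by case: z => a b; exact: sqrtr_ge0. Qed.

Lemma sqr_normcE z : normc z ^+ 2 = complex.Re z ^+ 2 + complex.Im z ^+ 2.
Proof. by case: z => a b /=; rewrite sqr_sqrtr// addr_ge0// sqr_ge0. Qed.

Lemma normr_Re_le z : `|complex.Re z| <= normc z.
Proof. by rewrite -lecR -normr_normc normc_ge_Re. Qed.

Lemma normr_Im_le z : `|complex.Im z| <= normc z.
Proof.
rewrite -ler_sqr ?nnegrE ?normc_ge0// sqr_normcE real_normK ?num_real//.
by rewrite lerDr sqr_ge0.
Qed.

Lemma normc_le_Re_Im z : normc z <= `|complex.Re z| + `|complex.Im z|.
Proof.
rewrite -ler_sqr ?nnegrE ?addr_ge0 ?normc_ge0// sqr_normcE sqrrD.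
rewrite !real_normK ?num_real//.
by rewrite addrAC lerDl mulrn_wge0// mulr_ge0.
Qed.

Lemma normcB z1 z2 : normc (z1 - z2) = normc (z2 - z1).
Proof. by rewrite -(normcN (z2 - z1)) opprB. Qed.

Lemma det_neq0_perturbC n (A : 'M[R[i]]_n) : \det A != 0 ->
  exists2 e : R, 0 < e &
    forall M : 'M[R[i]]_n, (forall i j, normc (M i j - A i j) <= e) -> \det M != 0.
Proof.
move=> /det_neq0_perturb[e e0 AM].
have eR : (complex.Re e)%:C = e by rewrite RRe_real// gtr0_real.
exists (complex.Re e) => [|M MA]; first by rewrite -ltcR eR.
by apply: AM => i j; rewrite -eR normr_normc lecR.
Qed.

End normc.

(** How a nonzero minor yields independence: M collects the values at the points
    x_i of the functions whose combination with coefficients c vanishes. *)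
Lemma det_neq0_cancel (F : fieldType) n (M : 'M[F]_n) (c : 'I_n -> F) :
  \det M != 0 -> (forall i, \sum_j c j * M i j = 0) -> forall j, c j = 0.
Proof.
move=> dM Mc j.
have Mu : M^T \in unitmx by rewrite unitmx_tr unitmxE unitfE.
suff /rowP/(_ j) : \row_i c i = 0 by rewrite !mxE.
rewrite -(mulmxK Mu (\row_i c i)) [X in X *m _](_ : _ = 0) ?mul0mx//.
apply/rowP => i; rewrite !mxE -[RHS](Mc i).
by apply: eq_bigr => k _; rewrite !mxE.
Qed.

(** * Lebesgue measure on row vectors *)

Section lebesgue_rV_theory.
Variable R : realType.

Lemma consr_ord0 n (p : 'rV[R]_n * measurableTypeR R) :
  consr p ord0 ord0 = p.2.
Proof.
rewrite /consr (_ : ord0 = lshift n (ord0 : 'I_1)); last exact/val_inj.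
by rewrite [LHS]row_mxEl mxE eqxx mulr1n.
Qed.

Lemma consr_lift n (p : 'rV[R]_n * measurableTypeR R) j :
  consr p ord0 (lift ord0 j) = p.1 ord0 j.
Proof.
rewrite /consr (_ : lift ord0 j = rshift 1 j); last exact/val_inj.
by rewrite [LHS]row_mxEr.
Qed.

(** Balls for the maximum norm are cubes, and consr splits a cube into the
    product of a cube and an interval. *)
Lemma lebesgue_rV_ball n (x : 'rV[R]_n) (e : R) : 0 < e ->
  lebesgue_rV R n (ball x e) = ((e *+ 2) ^+ n)%:E.
Proof.
move=> e0; elim: n x => [|n IH] x.
  by rewrite /= diracE expr0 mem_set//; split => // i [].
pose x1 : 'rV[R]_n := \row_j x ord0 (lift ord0 j).
rewrite /= /lebesgue_rVS /pushforward.
have -> : @consr R n @^-1` ball x e = ball x1 e `*` ball (x ord0 ord0) e.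
  apply/seteqP; split=> [[p s] [_ xp]|[p s] /= [[_ xp] xs]].
    split=> /=; [split=> // i j|].
      by have := xp ord0 (lift ord0 j); rewrite consr_lift (ord1 i) mxE.
    by have := xp ord0 ord0; rewrite consr_ord0.
  split=> // i j; rewrite (ord1 i).
  have [k ->|->] := unliftP ord0 j; last by rewrite consr_ord0.
  by have := xp ord0 k; rewrite consr_lift mxE.
rewrite product_measure1E; last 2 first.
- exact: open_measurable_rV (ball_open _ _).
- exact: measurable_ball.
rewrite exprSr EFinM; congr (_ * _)%E; first exact: IH.
by apply: lebesgue_measure_ball; exact: ltW.
Qed.

Lemma lebesgue_rV_open_gt0 n (U : set 'rV[R]_n) (x : 'rV[R]_n) : open U -> U x ->
  (0 < lebesgue_rV R n U)%E.
Proof.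
move=> oU Ux.
have /nbhs_ballP[e /= e0 xU] : nbhs x U by exact: open_nbhs_nbhs.
apply: (@lt_le_trans _ _ (lebesgue_rV R n (ball x e))).
  by rewrite lebesgue_rV_ball// lte_fin exprn_gt0// pmulrn_lgt0.
apply: le_measure => //; rewrite inE; apply: open_measurable_rV => //.
exact: ball_open.
Qed.

Lemma lebesgue_rV_bounded_lty n (U : set 'rV[R]_n) : measurable U ->
  bounded_set U -> (lebesgue_rV R n U < +oo)%E.
Proof.
move=> mU [M [_ UM]].
pose e : R := `|M| + 2.
have e0 : 0 < e by rewrite ltr_wpDl.
apply: (@le_lt_trans _ _ (lebesgue_rV R n (ball 0 e))).
  apply: le_measure => [||x Ux]; rewrite ?inE//.
    exact: open_measurable_rV (ball_open _ _).
  rewrite -ball_normE /ball_/= sub0r normrN.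
  apply: (@le_lt_trans _ _ (`|M| + 1)); last by rewrite ltrD2l ltr1n.
  apply: UM => //; rewrite (le_lt_trans (ler_norm M))// ltrDl//.
by rewrite lebesgue_rV_ball// ltry.
Qed.

(** The hypothesis is continuity of the restriction of u to X, so preimages of
    open intervals in the open set X are open. *)
Lemma measurable_fun_open_rV n (X : set 'rV[R]_n) (u : 'rV[R]_n -> R) : open X ->
  (forall x, X x -> forall e, 0 < e ->
     exists2 r, 0 < r & forall y, X y -> `|x - y| < r -> `|u x - u y| < e) ->
  measurable_fun X u.
Proof.
move=> oX cu; apply: (measurability _ (RGenOpens.measurableE R)).
move=> _ [_ [a [b ->] <-]]; apply: open_measurable_rV.
rewrite openE => x [Xx]; rewrite /= in_itv/= => /andP[au ub].
have e0 : 0 < Num.min (u x - a) (b - u x) by rewrite lt_min !subr_gt0 au.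
have [r r0 xr] := cu x Xx _ e0.
have /nbhs_ballP[s /= s0 xs] : nbhs x X by exact: open_nbhs_nbhs.
apply/nbhs_ballP; exists (Num.min r s) => /=; first by rewrite lt_min r0.
move=> y; rewrite -ball_normE /ball_/= lt_min => /andP[yr ys].
have Xy : X y by apply: xs; rewrite -ball_normE.
split => //=; have := xr y Xy yr; rewrite in_itv/= lt_min.
by rewrite !ltr_norml => /andP[/andP[? ?] /andP[? ?]]; lra.
Qed.

End lebesgue_rV_theory.

(** * Complex integrals *)

Section Cintegral.
Local Open Scope complex_scope.
Variables (R : realType) (d : nat) (Y : set 'rV[R]_d).
Hypothesis mY : measurable Y.
Local Notation mu := (lebesgue_rV R d).
Implicit Types (h : 'rV[R]_d -> R[i]^o).

Definition Cintegrable h :=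
  mu.-integrable Y (EFin \o (fun y => complex.Re (h y))) /\
  mu.-integrable Y (EFin \o (fun y => complex.Im (h y))).

Lemma CintegrableZ a h : Cintegrable h -> Cintegrable (fun y => a * h y).
Proof.
move=> [hr hi]; case: a => a b; split.
  apply: (eq_integrable mY (fun y => a%:E * (complex.Re (h y))%:E
    - b%:E * (complex.Im (h y))%:E)%E).
    by move=> y _ /=; case: (h y).
  by apply: integrableB => //; exact: integrableZl.
apply: (eq_integrable mY (fun y => a%:E * (complex.Im (h y))%:E
  + b%:E * (complex.Re (h y))%:E)%E).
  by move=> y _ /=; case: (h y).
by apply: integrableD => //; exact: integrableZl.
Qed.

Lemma CintegrableD h1 h2 : Cintegrable h1 -> Cintegrable h2 ->
  Cintegrable (fun y => h1 y + h2 y).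
Proof.
move=> [r1 i1] [r2 i2]; split.
  apply: (eq_integrable mY
    (fun y => (complex.Re (h1 y))%:E + (complex.Re (h2 y))%:E)%E).
    by move=> y _ /=; case: (h1 y); case: (h2 y).
  exact: integrableD.
apply: (eq_integrable mY
    (fun y => (complex.Im (h1 y))%:E + (complex.Im (h2 y))%:E)%E).
  by move=> y _ /=; case: (h1 y); case: (h2 y).
exact: integrableD.
Qed.

Lemma Cintegrable0 : Cintegrable (fun=> 0).
Proof. by split; exact: integrable0. Qed.

Lemma CintegralZ a h : Cintegrable h ->
  Cintegral Y (fun y => a * h y) = a * Cintegral Y h.
Proof.
move=> [hr hi]; case: a => a b; rewrite /Cintegral.
have ir c : mu.-integrable Y (EFin \o (fun y => c * complex.Re (h y))).
  exact: (integrableZl mY c hr).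
have ii c : mu.-integrable Y (EFin \o (fun y => c * complex.Im (h y))).
  exact: (integrableZl mY c hi).
apply/eqP; rewrite eq_complex/=; apply/andP; split; apply/eqP.
  rewrite -!RintegralZl// -RintegralB//.
  by apply: eq_Rintegral => y _; case: (h y).
rewrite -!RintegralZl// -RintegralD//.
by apply: eq_Rintegral => y _; case: (h y).
Qed.

Lemma CintegralD h1 h2 : Cintegrable h1 -> Cintegrable h2 ->
  Cintegral Y (fun y => h1 y + h2 y) = Cintegral Y h1 + Cintegral Y h2.
Proof.
move=> [r1 i1] [r2 i2]; rewrite /Cintegral.
apply/eqP; rewrite eq_complex/= -!RintegralD//; apply/andP; split; apply/eqP;
  by apply: eq_Rintegral => y _; case: (h1 y); case: (h2 y).
Qed.

Lemma eq_Cintegral h1 h2 : {in Y, h1 =1 h2} -> Cintegral Y h1 = Cintegral Y h2.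
Proof.
by move=> h12; congr (_ +i* _); apply: eq_Rintegral => y yY; rewrite h12.
Qed.

Lemma Cintegral0 : Cintegral Y (fun=> 0) = 0.
Proof. by rewrite /Cintegral/= Rintegral_cst// mul0r. Qed.

Lemma Cintegrable_sum n (c : 'I_n -> R[i]) (h : 'I_n -> 'rV[R]_d -> R[i]^o) :
  (forall j, Cintegrable (h j)) -> Cintegrable (fun y => \sum_j c j * h j y).
Proof.
move=> ih; have -> : (fun y => \sum_j c j * h j y) =
    \big[(fun f g y => f y + g y)/(fun=> 0)]_j (fun y => c j * h j y).
  by apply/funext => y; elim/big_rec2 : _ => // j f s _ ->.
elim/big_ind : _ => [|f g|j _]; [exact: Cintegrable0|exact: CintegrableD|].
exact: CintegrableZ.
Qed.

Lemma Cintegral_sum n (c : 'I_n -> R[i]) (h : 'I_n -> 'rV[R]_d -> R[i]^o) :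
  (forall j, Cintegrable (h j)) ->
  Cintegral Y (fun y => \sum_j c j * h j y) = \sum_j c j * Cintegral Y (h j).
Proof.
elim: n c h => [|n IH] c h ih.
  rewrite big_ord0 -[RHS]Cintegral0; congr Cintegral.
  by apply/funext => y; rewrite big_ord0.
rewrite big_ord_recl -IH// -CintegralZ// -CintegralD.
- by congr Cintegral; apply/funext => y; rewrite big_ord_recl.
- exact: CintegrableZ.
- exact: Cintegrable_sum.
Qed.

Lemma ae_eq_Cintegral h1 h2 : Cintegrable h1 -> Cintegrable h2 ->
  (\forall y \ae mu, Y y -> h1 y = h2 y) -> Cintegral Y h1 = Cintegral Y h2.
Proof.
move=> [r1 i1] [r2 i2] h12; congr (_ +i* _); congr fine.
  apply: ae_eq_integral => //.
  - exact: measurable_int r1.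
  - exact: measurable_int r2.
  - by apply: filterS h12 => y /[apply] /= ->.
apply: ae_eq_integral => //.
- exact: measurable_int i1.
- exact: measurable_int i2.
- by apply: filterS h12 => y /[apply] /= ->.
Qed.

Lemma le_normr_RintegralW (u p : 'rV[R]_d -> R) :
  mu.-integrable Y (EFin \o u) -> mu.-integrable Y (EFin \o p) ->
  (forall y, Y y -> `|u y| <= p y) ->
  `|\int[mu]_(y in Y) u y| <= \int[mu]_(y in Y) p y.
Proof.
move=> iu ip up; apply: (le_trans (le_normr_Rintegral mY iu)).
apply: le_Rintegral => //.
by have := integrable_abse iu.
Qed.

(** The constant 2 comes from bounding the real and imaginary parts separately;
    the estimates that rest on it only matter up to a constant factor. *)
Lemma normc_Cintegral_le h (p : 'rV[R]_d -> R) : Cintegrable h ->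
  mu.-integrable Y (EFin \o p) -> (forall y, Y y -> normc (h y) <= p y) ->
  normc (Cintegral Y h) <= (\int[mu]_(y in Y) p y) *+ 2.
Proof.
move=> [hr hi] ip hp; apply: (le_trans (normc_le_Re_Im _)); rewrite mulr2n.
apply: lerD; apply: le_normr_RintegralW => // y Yy.
  exact: le_trans (normr_Re_le _) (hp _ Yy).
exact: le_trans (normr_Im_le _) (hp _ Yy).
Qed.

End Cintegral.

(** * Square-integrable functions *)

Section square_integrable.
Local Open Scope complex_scope.
Variables (R : realType) (d : nat) (Y : set 'rV[R]_d).
Hypotheses (oY : open Y) (bY : bounded_set Y).
Local Notation mu := (lebesgue_rV R d).
Implicit Types (u v g : 'rV[R]_d -> R[i]^o).

Let mY : measurable Y. Proof. exact: open_measurable_rV. Qed.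
Let Yfin : (mu Y < +oo)%E. Proof. exact: lebesgue_rV_bounded_lty. Qed.

(** The multipliers that send square-integrable functions to integrable ones;
    the rows and columns of the kernel are of this kind. *)
Definition bounded_measurable u :=
  [/\ measurable_fun Y (fun x => complex.Re (u x)),
      measurable_fun Y (fun x => complex.Im (u x)) &
      exists M : R, forall y, Y y -> normc (u y) <= M].

Lemma continuous_bounded_measurable u (M : R) :
  (forall x, Y x -> forall e, 0 < e ->
     exists2 r, 0 < r & forall y, Y y -> `|x - y| < r -> normc (u x - u y) < e) ->
  (forall y, Y y -> normc (u y) <= M) -> bounded_measurable u.
Proof.
move=> cu uM; split; last by exists M.
- apply: measurable_fun_open_rV => // x Yx e e0.
  have [r r0 xr] := cu x Yx e e0; exists r => // y Yy /(xr _ Yy).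
  by apply: le_lt_trans; rewrite -raddfB normr_Re_le.
- apply: measurable_fun_open_rV => // x Yx e e0.
  have [r r0 xr] := cu x Yx e e0; exists r => // y Yy /(xr _ Yy).
  by apply: le_lt_trans; rewrite -raddfB normr_Im_le.
Qed.

Lemma bounded_measurable_L2 u : bounded_measurable u -> u \in L2pred mu Y.
Proof.
move=> [ur ui [M uM]]; rewrite inE => _; split => //.
apply: (@le_lt_trans _ _ (\int[mu]_(x in Y) (M ^+ 2)%:E)%E).
  apply: ge0_le_integral => //.
  - by move=> x _; rewrite lee_fin sqr_ge0.
  - apply/measurable_EFinP; under eq_fun do rewrite sqr_normcE.
    by apply: measurable_funD; exact: measurable_funX.
  - move=> x Yx; rewrite lee_fin lerXn2r ?nnegrE ?normc_ge0// ?uM//.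
    by rewrite (le_trans _ (uM _ Yx)) ?normc_ge0.
by rewrite integral_cst// lte_mul_pinfty// lee_fin sqr_ge0.
Qed.

Lemma eq_L2pred u v : (forall x, Y x -> u x = v x) ->
  u \in L2pred mu Y -> v \in L2pred mu Y.
Proof.
move=> uv; rewrite !inE => + _ => /(_ mY)[ur ui uf]; split.
- by apply: eq_measurable_fun ur => x /set_mem /uv ->.
- by apply: eq_measurable_fun ui => x /set_mem /uv ->.
- rewrite (eq_integral (fun x => (normc (u x) ^+ 2)%:E))// => x /set_mem Yx.
  by rewrite uv.
Qed.

(** On a set of finite measure, square-integrable functions are integrable. *)
Lemma bounded_mul_integrable (b p : 'rV[R]_d -> R) g (M : R) :
  measurable_fun Y b -> (forall y, Y y -> `|b y| <= M) ->
  measurable_fun Y p -> (forall y, Y y -> `|p y| <= normc (g y)) ->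
  g \in L2pred mu Y ->
  mu.-integrable Y (EFin \o (fun y => b y * p y)).
Proof.
move=> mb bM mp pg; rewrite inE => /(_ mY)[gr gi gf].
have ic (c : R) : mu.-integrable Y (cst c%:E).
  apply: (@measurable_bounded_integrable _ _ _ mu (cst c)) => //.
  exact: bounded_cst.
have ig : mu.-integrable Y (fun y => (normc (g y) ^+ 2)%:E).
  apply/integrableP; split.
    apply/measurable_EFinP; under eq_fun do rewrite sqr_normcE.
    by apply: measurable_funD; exact: measurable_funX.
  by under eq_integral do rewrite gee0_abs ?lee_fin ?sqr_ge0//.
apply: (@le_integrable _ _ _ mu Y mY _
  (fun y => `|M|%:E * (cst 1%:E y + (normc (g y) ^+ 2)%:E))%E).
- by apply/measurable_EFinP; exact: measurable_funM.
- move=> y Yy /=; rewrite lee_fin !normrM normr_id.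
  apply: ler_pM => //; first exact: le_trans (bM _ Yy) (ler_norm _).
  apply: le_trans (pg _ Yy) _; apply: le_trans (ler_norm _).
  (* t <= 1 + t ^+ 2 *)
  by have := normc_ge0 (g y); move: (normc (g y)) => t t0; nra.
- by apply: integrableZl => //; exact: integrableD.
Qed.

Lemma bounded_mul_Cintegrable u g : bounded_measurable u ->
  g \in L2pred mu Y -> Cintegrable Y (fun y => u y * g y).
Proof.
move=> [ur ui [M uM]] gL; have := gL; rewrite inE => /(_ mY)[gr gi _].
have urM y : Y y -> `|complex.Re (u y)| <= M.
  by move=> /uM; apply: le_trans; exact: normr_Re_le.
have uiM y : Y y -> `|complex.Im (u y)| <= M.
  by move=> /uM; apply: le_trans; exact: normr_Im_le.
have gr' y : Y y -> `|complex.Re (g y)| <= normc (g y).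
  by move=> _; exact: normr_Re_le.
have gi' y : Y y -> `|complex.Im (g y)| <= normc (g y).
  by move=> _; exact: normr_Im_le.
have rr := bounded_mul_integrable ur urM gr gr' gL.
have ii := bounded_mul_integrable ui uiM gi gi' gL.
have ri := bounded_mul_integrable ur urM gi gi' gL.
have ir := bounded_mul_integrable ui uiM gr gr' gL.
split.
  apply: (eq_integrable mY (fun y => (complex.Re (u y) * complex.Re (g y))%:E
    - (complex.Im (u y) * complex.Im (g y))%:E)%E).
    by move=> y _ /=; case: (u y); case: (g y).
  exact: integrableB.
apply: (eq_integrable mY (fun y => (complex.Re (u y) * complex.Im (g y))%:E
  + (complex.Im (u y) * complex.Re (g y))%:E)%E).
  by move=> y _ /=; case: (u y); case: (g y).
exact: integrableD.
Qed.

End square_integrable.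

Section L2_classes.
Local Open Scope complex_scope.
Local Open Scope quotient_scope.
Variables (R : realType) (d : nat) (X : set 'rV[R]_d).
Hypothesis oX : open X.
Local Notation mu := (lebesgue_rV R d).
Local Notation pi := (\pi_(L2rV X)).

Let mX : measurable X. Proof. exact: open_measurable_rV. Qed.

(** Lifts a pointwise identity on X to L^2(X), and shows at the same time that
    the default value in L2class is not used. *)
Lemma L2class_pi (u : 'rV[R]_d -> R[i]^o) (v : L2fun mu X) :
  (forall x, X x -> v x = u x) -> L2class X u = pi v.
Proof.
move=> vu; have uL : u \in L2pred mu X by apply: (eq_L2pred oX vu); exact: valP.
rewrite /L2class; apply/pi_L2P; apply: aeW => x Xx.
have -> : L2val (insubd (0 : L2fun mu X) u) = u by exact: (insubdK _ uL).
by rewrite vu.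
Qed.

Lemma pi_L2_sum n (c : 'I_n -> R[i]) (v : 'I_n -> L2fun mu X) :
  pi (\sum_j c j *: v j) = \sum_j c j *: pi (v j).
Proof.
rewrite (big_morph pi (id1 := 0) (op1 := +%R) (@pi_L2D _ _ _ _ _)).
  by apply: eq_bigr => j _; exact: pi_L2Z.
by rewrite piE.
Qed.

Lemma L2val_sum n (c : 'I_n -> R[i]) (v : 'I_n -> L2fun mu X) x :
  (\sum_j c j *: v j : L2fun mu X) x = \sum_j c j * v j x.
Proof. by elim/big_rec2 : _ => // j f s _ <-. Qed.

Lemma pi_L2_eq0 (v : L2fun mu X) : pi v = 0 -> \forall x \ae mu, X x -> v x = 0.
Proof.
have -> : 0 = pi (0 : L2fun mu X) by rewrite piE.
by move=> /pi_L2P.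
Qed.

(** A nonempty open set has positive measure, so it is not negligible. *)
Lemma ae_in_open (P : 'rV[R]_d -> Prop) (U : set 'rV[R]_d) (a : 'rV[R]_d) :
  (\forall x \ae mu, P x) -> open U -> U a -> exists2 x, U x & P x.
Proof.
move=> aeP oU Ua; apply: contrapT => none.
have : mu.-negligible U.
  by apply: negligibleS aeP => x Ux Px; apply: none; exists x.
move=> /(negligibleP _ (open_measurable_rV oU)) U0.
by have := lebesgue_rV_open_gt0 oU Ua; rewrite U0 ltxx.
Qed.

End L2_classes.

(** * The integral operator of a kernel *)

Section kernel_op.
Local Open Scope complex_scope.
Local Open Scope quotient_scope.
Variables (R : realType) (d : nat) (X Y : set 'rV[R]_d).
Hypotheses (oX : open X) (bX : bounded_set X) (oY : open Y) (bY : bounded_set Y).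
Local Notation mu := (lebesgue_rV R d).
Local Notation T := ('rV[R]_d).

Let mX : measurable X. Proof. exact: open_measurable_rV. Qed.
Let mY : measurable Y. Proof. exact: open_measurable_rV. Qed.

(** The common form of the truncated correlation and convolution operators, to
    which both are convertible. *)
Definition kernel_op (k : T -> T -> R[i]) (g : L2rV Y) : L2rV X :=
  L2class X (fun x => Cintegral Y (fun y => k x y * repr g y)).

Definition unif_continuous_kernel (k : T -> T -> R[i]) : Prop :=
  forall e : R, 0 < e -> exists2 r : R, 0 < r &
    forall x x' y y', X x -> X x' -> Y y -> Y y' ->
      `|x - x'| < r -> `|y - y'| < r -> normc (k x y - k x' y') < e.

Variables (k : T -> T -> R[i]) (M : R).
Hypothesis kc : unif_continuous_kernel k.
Hypothesis kM : forall x y, X x -> Y y -> normc (k x y) <= M.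

Lemma kernel_col_bounded_measurable y : Y y -> bounded_measurable X (k^~ y).
Proof.
move=> Yy; apply: (continuous_bounded_measurable oX (M := M)) => [x Xx e e0|x Xx].
  have [r r0 kr] := kc e0; exists r => // x' Xx' xx'.
  by apply: kr => //; rewrite subrr normr0.
exact: kM.
Qed.

Lemma kernel_row_bounded_measurable x : X x -> bounded_measurable Y (k x).
Proof.
move=> Xx; apply: (continuous_bounded_measurable oY (M := M)) => [y Yy e e0|y Yy].
  have [r r0 kr] := kc e0; exists r => // y' Yy' yy'.
  by apply: kr => //; rewrite subrr normr0.
exact: kM.
Qed.

(** The integral of a separated kernel against g is a combination of the r
    columns, with coefficients the integrals of g against the row functions. *)
Lemma indep_range_has_minor n :
  indep_in (range (kernel_op k)) n -> has_minor k X Y n.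
Proof.
move=> [e [re ie]]; apply: contrapT => /separable_kernel.
move=> [r [x [y [B [rn Xx Yy kE]]]]].
have colL j : k^~ (y j) \in L2pred mu X.
  exact/(bounded_measurable_L2 oX bX)/kernel_col_bounded_measurable.
pose v j : L2fun mu X := MkL2fun (colL j).
suff span g : exists c : 'I_r -> R[i],
    kernel_op k g = \sum_j c j *: \pi_(L2rV X) (v j).
  have /choice[C eC] i : exists c : 'I_r -> R[i],
      e i = \sum_j c j *: \pi_(L2rV X) (v j).
    by have [g _ <-] := re i; exact: span.
  by have := independent_span_size eC ie; rewrite leqNgt rn.
have ig i : Cintegrable Y (fun t => k (x i) t * repr g t).
  apply: bounded_mul_Cintegrable => //; last exact: valP.
  exact: kernel_row_bounded_measurable.
pose c j := \sum_i B j i * Cintegral Y (fun t => k (x i) t * repr g t).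
exists c; rewrite -pi_L2_sum; apply: L2class_pi => // s Xs; rewrite L2val_sum.
have -> : Cintegral Y (fun t => k s t * repr g t) =
    Cintegral Y (fun t => \sum_j k s (y j) *
      \sum_i B j i * (k (x i) t * repr g t)).
  apply: eq_Cintegral => t /set_mem Yt; rewrite kE// mulr_suml.
  apply: eq_bigr => j _; rewrite -mulrA mulr_suml; congr (_ * _).
  by apply: eq_bigr => i _; rewrite mulrA.
rewrite Cintegral_sum//; last by move=> j; exact: Cintegrable_sum.
by apply: eq_bigr => j _; rewrite Cintegral_sum// mulrC.
Qed.

Lemma bounded_measurable_cst a : bounded_measurable Y (fun=> a : R[i]).
Proof.
by split; [exact: measurable_cst|exact: measurable_cst|exists (normc a)].
Qed.

Section average.
Variables (b : T) (r : R).
Hypotheses (r0 : 0 < r) (brY : ball b r `<=` Y).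

(** The uniform density on the cube of centre b and half-side r. *)
Definition density (y : T) : R := \1_(ball b r) y / (r *+ 2) ^+ d.

Let vol : 0 < (r *+ 2) ^+ d. Proof. by rewrite exprn_gt0// pmulrn_lgt0. Qed.

Let mball : measurable (ball b r : set T).
Proof. exact: open_measurable_rV (ball_open _ _). Qed.

Lemma density_ge0 y : 0 <= density y.
Proof. by rewrite divr_ge0// ltW. Qed.

Lemma measurable_density : measurable_fun Y density.
Proof.
apply: measurable_funM => //; exact: measurable_funTS (measurable_indic _).
Qed.

Lemma integral_density : (\int[mu]_(y in Y) (density y)%:E = 1)%E.
Proof.
under eq_integral do rewrite /density mulrC EFinM.
rewrite ge0_integralZl//; last 2 first.
- by apply/measurable_EFinP; exact: measurable_funTS (measurable_indic _).
- by rewrite lee_fin invr_ge0 ltW.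
rewrite integral_indic// setIidl// lebesgue_rV_ball// -EFinM mulVf//.
exact: lt0r_neq0.
Qed.

Lemma integrable_density : mu.-integrable Y (EFin \o density).
Proof.
apply/integrableP; split; first by apply/measurable_EFinP; exact: measurable_density.
under eq_integral do rewrite /= ger0_norm ?density_ge0//.
by rewrite integral_density ltry.
Qed.

Lemma density_bounded_measurable :
  bounded_measurable Y (fun y => (density y)%:C).
Proof.
split; [exact: measurable_density|exact: measurable_cst|].
exists ((r *+ 2) ^+ d)^-1 => y _ /=; rewrite expr0n addr0 sqrtr_sqr.
rewrite ger0_norm ?density_ge0//.
by rewrite /density ler_pdivrMr// mulVf ?lt0r_neq0//.
Qed.

(** The average of w over the cube, written as the integral operator writes it:
    average b r (k x) is the value at x of the image of the density. *)
Definition average (w : T -> R[i]^o) : R[i] :=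
  Cintegral Y (fun y => w y * (density y)%:C).

Lemma Cintegrable_average w : bounded_measurable Y w ->
  Cintegrable Y (fun y => w y * (density y)%:C).
Proof.
move=> bw; apply: bounded_mul_Cintegrable => //.
exact/(bounded_measurable_L2 oY _)/density_bounded_measurable.
Qed.

(** Applied to two rows of the kernel, it gives continuity of the averages;
    applied to a row and a constant, through average_cst, it compares an average
    with a value of the kernel. *)
Lemma average_dist w w' e : bounded_measurable Y w -> bounded_measurable Y w' ->
  (forall y, ball b r y -> normc (w y - w' y) <= e) ->
  normc (average w - average w') <= e *+ 2.
Proof.
move=> bw bw' ww'.
have iw := Cintegrable_average bw; have iw' := Cintegrable_average bw'.
have iNw' := CintegrableZ mY (-1) iw'.
rewrite /average -mulN1r -CintegralZ// -CintegralD//.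
have -> : e *+ 2 = (\int[mu]_(y in Y) (e * density y)) *+ 2.
  rewrite RintegralZl//; last exact: integrable_density.
  by rewrite /Rintegral integral_density mulr1.
apply: normc_Cintegral_le => //.
- exact: CintegrableD.
- exact: (integrableZl mY e integrable_density).
move=> y Yy; rewrite mulN1r -mulrBl Normc.normcM.
rewrite [X in _ * X](_ : _ = density y); last first.
  by rewrite /= expr0n addr0 sqrtr_sqr ger0_norm ?density_ge0.
have [yb|yb] := pselect (ball b r y); first by rewrite ler_wpM2r ?density_ge0 ?ww'.
by rewrite /density indicE memNset// mul0r !mulr0.
Qed.

Lemma average_cst a : average (fun=> a) = a.
Proof.
have i1 : Cintegrable Y (fun y => (density y)%:C : R[i]^o).
  by have := Cintegrable_average (bounded_measurable_cst 1); under eq_fun do rewrite mul1r.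
rewrite /average CintegralZ// /Cintegral/= /Rintegral integral_density.
by rewrite integral0 mulr1.
Qed.

End average.

Lemma average_kernel_bounded_measurable b r : 0 < r -> ball b r `<=` Y ->
  bounded_measurable X (fun x => average b r (k x)).
Proof.
move=> r0 brY.
apply: (continuous_bounded_measurable oX (M := M *+ 2)) => [x Xx e e0|x Xx].
  have e4 : 0 < e / 4 by rewrite divr_gt0.
  have [s s0 ks] := kc e4; exists s => // x' Xx' xx'.
  apply: (@le_lt_trans _ _ ((e / 4) *+ 2)); last by lra.
  apply: average_dist => //; try exact: kernel_row_bounded_measurable.
  by move=> y /brY Yy; apply/ltW/ks => //; rewrite subrr normr0.
rewrite -[average _ _ _]subr0 -[0](average_cst r0 brY).
apply: average_dist => //; first exact: kernel_row_bounded_measurable.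
  exact: bounded_measurable_cst.
by move=> y /brY Yy; rewrite subr0; exact: kM.
Qed.

(** The representative of the class of v that the operator integrates agrees
    with the density only almost everywhere, which the integral does not see. *)
Lemma kernel_op_density b r (v : L2fun mu Y) :
  0 < r -> ball b r `<=` Y -> (forall y, v y = (density b r y)%:C) ->
  forall (h : L2fun mu X), (forall x, X x -> h x = average b r (k x)) ->
  kernel_op k (\pi_(L2rV Y) v) = \pi_(L2rV X) h.
Proof.
move=> r0 brY vE h hE; apply: L2class_pi => // x Xx; rewrite hE//.
have bk := kernel_row_bounded_measurable Xx.
apply: ae_eq_Cintegral => //.
- exact: Cintegrable_average.
- by apply: bounded_mul_Cintegrable => //; exact: valP.
have /pi_L2P : \pi_(L2rV Y) (repr (\pi_(L2rV Y) v)) = \pi_(L2rV Y) v by rewrite reprK.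
by apply: filterS => y /[apply] ->; rewrite vE.
Qed.

(** The preimages are the densities on cubes around the y_j, small enough for the
    kernel to vary by less than e / 2. Independence is tested at points x'_i near
    the x_i that avoid the null set where the combination of the images fails to
    vanish. *)
Lemma has_minor_indep_range n :
  has_minor k X Y n -> indep_in (range (kernel_op k)) n.
Proof.
move=> [x [y [Xx Yy /det_neq0_perturbC[e e0 eP]]]].
have e2 : 0 < e / 2 by rewrite divr_gt0.
have [s s0 ks] := kc e2.
have [r [r0 rs rY]] : exists r, [/\ 0 < r, r <= s & forall j, ball (y j) r `<=` Y].
  have : \forall r \near 0^'+, forall j, ball (y j) r `<=` Y.
    apply: filter_forall => j.
    have /nbhs_ballP[a /= a0 aY] : nbhs (y j) Y by exact: open_nbhs_nbhs.
    near=> r; apply: subset_trans aY; apply: le_ball; near: r.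
    exact: nbhs_right_le.
  move=> rY; apply: (@filter_ex _ (0^'+ : set_system R)).
  near=> r; split; near: r; [exact: nbhs_right_gt|exact: nbhs_right_le|exact: rY].
have vL j : (fun t => (density (y j) r t)%:C) \in L2pred mu Y.
  exact/(bounded_measurable_L2 oY bY)/density_bounded_measurable.
have hL j : (fun s => average (y j) r (k s)) \in L2pred mu X.
  exact/(bounded_measurable_L2 oX bX)/average_kernel_bounded_measurable.
pose h j : L2fun mu X := MkL2fun (hL j).
exists (fun j => \pi_(L2rV X) (h j)); split=> [j|c].
  exists (\pi_(L2rV Y) (MkL2fun (vL j))) => //.
  by apply: (kernel_op_density r0 (@rY j)).
rewrite -pi_L2_sum => /pi_L2_eq0 c0.
have /choice[x' x'P] i : exists x', [/\ X x', `|x i - x'| < s &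
    \sum_j c j * average (y j) r (k x') = 0].
  have [|x' [Xx' xx'] P] := ae_in_open c0 (openI oX (ball_open (x i) s)) (a := x i).
    by split => //; exact: ballxx.
  exists x'; split => //; first by move: xx'; rewrite -ball_normE.
  by rewrite -[RHS](P Xx') L2val_sum.
apply: (@det_neq0_cancel _ n (\matrix_(i, j) average (y j) r (k (x' i)))); last first.
  move=> i; have [_ _ sum0] := x'P i; rewrite -[RHS]sum0.
  by apply: eq_bigr => j _; rewrite mxE.
apply: eP => i j; rewrite !mxE.
have [Xx' xx' _] := x'P i.
rewrite -[X in _ - X](average_cst r0 (@rY j)) [leRHS](_ : _ = (e / 2) *+ 2); last by lra.
apply: average_dist => //.
- exact: kernel_row_bounded_measurable.
- exact: bounded_measurable_cst.
- move=> t yt; rewrite normcB; apply/ltW/ks => //; first exact: rY yt.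
  by move: yt; rewrite -ball_normE /ball_/= => /lt_le_trans; exact.
Unshelve. all: by end_near. Qed.

End kernel_op.

(** * The discretized operator *)

Section grid.
Variables (R : realType) (d : nat).
Implicit Types (X Y : set 'rV[R]_d) (l : R).

(** Every coordinate of a grid point of Y is l times an integer in [-N, N[, and
    the finitely many candidates are indexed by ordinals shifted by N. *)
Lemma finite_grid l Y : 0 < l -> bounded_set Y -> finite_set (grid l Y).
Proof.
move=> l0 [B [_ YB]].
pose N := (Num.Def.truncn ((`|B| + 2) / l)).+1.
pose F (a : 'rV['I_(N + N)]_d) : 'rV[R]_d :=
  l *: map_mx intr (\row_i ((a ord0 i : nat)%:Z - N%:Z)).
apply: (@sub_finite_set _ _ (F @` setT)); last exact: finite_image.
move=> x [Yx [n xE]].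
have nN i : `|n ord0 i| < N%:Z.
  rewrite -(ltr_int R) intr_norm /N.
  apply: le_lt_trans (truncnS_gt _); rewrite ler_pdivlMr// mulrC.
  have -> : l * `|(n ord0 i)%:~R| = `|x ord0 i|.
    by rewrite xE !mxE normrM gtr0_norm.
  have xB : ball (0 : 'rV[R]_d) (`|B| + 2) x.
    rewrite -ball_normE /ball_/= sub0r normrN.
    apply: (@le_lt_trans _ _ (`|B| + 1)); last by rewrite ltrD2l ltr1n.
    by apply: YB => //; rewrite (le_lt_trans (ler_norm B))// ltrDl.
  by have := xB.2 ord0 i; rewrite mxE -ball_normE /ball_/= sub0r normrN => /ltW.
have nN' i : (absz (n ord0 i + N%:Z)%R < N + N)%N by have := nN i; lia.
exists (\row_i Ordinal (nN' i)) => //; rewrite xE /F; congr (_ *: _).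
apply/rowP => i; rewrite !mxE/= ord1; congr (_ %:~R).
by move: (nN i); case: (n ord0 i) => m; lia.
Qed.

Lemma finite_grid_setT l Y : 0 < l -> bounded_set Y ->
  finite_set [set: grid l Y].
Proof.
move=> l0 bY; have -> : [set: grid l Y] = val @^-1` grid l Y.
  by apply/seteqP; split=> // x _; exact: set_valP.
apply: finite_preimage; last exact: finite_grid.
by move=> x y _ _; exact: val_inj.
Qed.

(** Rounding the coordinates of x down to multiples of l moves x by less than l
    in the maximum norm, so it stays in X for l small. *)
Lemma grid_approx X x (e : R) : open X -> X x -> 0 < e ->
  \forall l \near 0^'+, exists2 x', grid l X x' & `|x - x'| < e.
Proof.
move=> oX Xx e0.
have /nbhs_ballP[a /= a0 aX] : nbhs x X by exact: open_nbhs_nbhs.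
near=> l.
have l0 : 0 < l by near: l; exact: nbhs_right_gt.
pose n : 'rV[int]_d := \row_i Num.floor (x ord0 i / l).
have xn s : l <= s -> ball x s (l *: map_mx intr n).
  move=> ls; split=> [|i j]; first exact: lt_le_trans ls.
  rewrite (ord1 i) !mxE -ball_normE /ball_/=; apply: lt_le_trans ls.
  set q := x ord0 j / l; have -> : x ord0 j = l * q by rewrite mulrC divfK ?lt0r_neq0.
  rewrite -mulrBr normrM gtr0_norm// gtr_pMr//.
  have := floor_itv q; rewrite intrD => /andP[h1 h2].
  by rewrite ger0_norm ?subr_ge0// ltrBlDl.
exists (l *: map_mx intr n); last first.
  have : ball x e (l *: map_mx intr n).
    by apply: xn; near: l; exact: nbhs_right_le.
  by rewrite -ball_normE.
split; last by exists n.
by apply/aX/xn; near: l; exact: nbhs_right_le.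
Unshelve. all: by end_near. Qed.

End grid.

Section discrete_op.
Variables (R : realType) (d : nat) (X Y : set 'rV[R]_d) (l : R).
Hypotheses (l0 : 0 < l) (bY : bounded_set Y).
Variable k : 'rV[R]_d -> 'rV[R]_d -> R[i].

(** The common form of the two discretized operators, convertible to both. *)
Definition discrete_op (g : grid l Y -> R[i]^o) : grid l X -> R[i]^o :=
  fun x => \sum_(y \in [set: grid l Y]) k (val x) (val y) * g y.

(** Turns the finitely supported sums, all at once, into sums over one list, on
    which exchanging and distributing sums is available. *)
Lemma grid_sumE : exists s : seq (grid l Y), forall F : grid l Y -> R[i],
  \sum_(y \in [set: grid l Y]) F y = \sum_(y <- s) F y.
Proof. by eexists => F; apply: fsbig_finite; exact: finite_grid_setT. Qed.

Lemma indep_range_discrete_has_minor n :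
  indep_in (range discrete_op) n -> has_minor k (grid l X) (grid l Y) n.
Proof.
move=> [e [re ie]]; apply: contrapT => /separable_kernel.
move=> [r [x [y [B [rn Xx Yy kE]]]]].
pose v j : grid l X -> R[i]^o := fun s => k (val s) (y j).
suff span g : exists c : 'I_r -> R[i], discrete_op g = \sum_j c j *: v j.
  have /choice[C eC] i : exists c : 'I_r -> R[i], e i = \sum_j c j *: v j.
    by have [g _ <-] := re i; exact: span.
  by have := independent_span_size eC ie; rewrite leqNgt rn.
have [ts sumE] := grid_sumE.
pose c j := \sum_(t <- ts)
  (\sum_i B j i * k (x i) (val t)) * g t.
exists c; apply/funext => s; rewrite fct_sumE /discrete_op sumE.
under eq_bigr => t _ do rewrite (kE _ _ (set_valP s) (set_valP t)) mulr_suml.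
rewrite exchange_big/=; apply: eq_bigr => j _.
rewrite -[RHS]/(c j * v j s) mulr_suml; apply: eq_bigr => t _.
by rewrite [RHS]mulrC mulrA.
Qed.

Lemma has_minor_indep_range_discrete n :
  has_minor k (grid l X) (grid l Y) n -> indep_in (range discrete_op) n.
Proof.
move=> [x [y [Xx Yy dxy]]].
pose delta j : grid l Y -> R[i]^o := fun z => (val z == y j)%:R.
have opE j s : discrete_op (delta j) s = k (val s) (y j).
  pose z : grid l Y := SigSub (mem_set (Yy j)).
  rewrite /discrete_op -(@fsbig_widen _ _ _ _ [set z]) ?fsbig_set1//.
    by rewrite /delta eqxx mulr1.
  move=> t [_ tz]; have /negPf tyj : val t != y j.
    by apply/eqP => tyj; apply: tz; exact: val_inj.
  by rewrite /= /delta tyj mulr0.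
exists (fun j => discrete_op (delta j)); split=> [j|c c0]; first by exists (delta j).
apply: (det_neq0_cancel dxy) => i.
have := congr1 (fun f => f (SigSub (mem_set (Xx i)))) c0.
rewrite fct_sumE => E; apply: (etrans _ E); apply: eq_bigr => j _.
by rewrite mxE -[RHS]/(c j * discrete_op (delta j) _) opE.
Qed.

End discrete_op.

(** * Uniform continuity and the limit of the ranks *)

Section heine.
Local Open Scope complex_scope.
Variables (R : realType) (d : nat) (K : set 'rV[R]_d).
Variable f : 'rV[R]_d -> R[i]^o.
Hypotheses (cK : compact K) (cf : {within K, continuous f}).

Lemma within_continuous_dist z (e : R) : K z -> 0 < e ->
  exists2 r : R, 0 < r & forall x, K x -> `|z - x| < r -> normc (f z - f x) < e.
Proof.
move=> Kz e0; have /subspace_continuousP/(_ z Kz) fz := cf.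
have eC0 : 0 < e%:C by rewrite ltcR.
move/cvgrPdist_lt: fz => /(_ _ eC0); rewrite /within/= => /nbhs_ballP[r /= r0 rf].
exists r => // x Kx zx.
have := rf x; rewrite -ball_normE /ball_/= => /(_ zx Kx).
by rewrite normr_normc ltcR.
Qed.

(** Heine's theorem: near each z, radii below half the radius of continuity at z
    work, and compactness makes one radius work everywhere. *)
Lemma compact_unif_continuous (e : R) : 0 < e ->
  exists2 r : R, 0 < r & forall x y, K x -> K y -> `|x - y| < r ->
    normc (f x - f y) < e.
Proof.
move=> e0; have e20 : 0 < e / 2 by rewrite divr_gt0.
pose P (r : R) x := forall y, K x -> K y -> `|x - y| < r -> normc (f x - f y) < e.
have rP : \forall r \near 0^'+, K `<=` P r.
  apply: (iffLR (compact_near_coveringP K)) => // z Kz.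
  have [r r0 zr] := within_continuous_dist Kz e20.
  have r20 : 0 < r / 2 by rewrite divr_gt0.
  exists (ball z (r / 2), [set s | s < r / 2]).
    by split; [exact: nbhsx_ballx|exact: nbhs_right_lt].
  move=> [x s] [/= zx sr] y Kx Ky xy.
  rewrite -ball_normE /ball_/= in zx.
  rewrite -(subrK (f z) (f x)) -addrA.
  apply: le_lt_trans (le_normcD _ _) _; rewrite (splitr e) normcB.
  apply: ltrD; apply: zr => //; first by apply: lt_le_trans zx _; lra.
  rewrite -(subrK x z) -addrA (le_lt_trans (ler_normD _ _))//.
  by rewrite (splitr r) ltrD// (lt_trans xy).
have [r [r0 rK]] : exists r, 0 < r /\ K `<=` P r.
  apply: (@filter_ex _ (0^'+ : set_system R)).
  by near=> r; split; near: r; [exact: nbhs_right_gt|exact: rP].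
by exists r => // x y Kx; exact: rK.
Unshelve. all: by end_near. Qed.

Lemma compact_normc_bounded : exists M : R, forall x, K x -> normc (f x) <= M.
Proof.
pose P (M : R) x := K x -> normc (f x) <= M.
have MP : \forall M \near +oo, K `<=` P M.
  apply: (iffLR (compact_near_coveringP K)) => // z Kz.
  have [r r0 zr] := within_continuous_dist Kz ltr01.
  exists (ball z r, [set M | normc (f z) + 1 <= M]).
    by split; [exact: nbhsx_ballx|by apply: nbhs_pinfty_ge; exact: num_real].
  move=> [x M] [/= zx zM] Kx.
  rewrite -ball_normE /ball_/= in zx; apply: le_trans zM.
  rewrite -[f x](subrK (f z)) addrC (le_trans (le_normcD _ _))// lerD2l normcB.
  exact/ltW/zr.
have [M MK] : exists M, K `<=` P M by exact: (@filter_ex _ (+oo : set_system R)).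
by exists M => x Kx; exact: MK.
Qed.

End heine.

Section rank_limit.
Variables (R : realType) (d : nat) (X Y : set 'rV[R]_d).
Hypotheses (oX : open X) (bX : bounded_set X) (oY : open Y) (bY : bounded_set Y).
Variables (k : 'rV[R]_d -> 'rV[R]_d -> R[i]) (M : R).
Hypothesis kc : unif_continuous_kernel X Y k.
Hypothesis kM : forall x y, X x -> Y y -> normc (k x y) <= M.

(** Nonvanishing of a minor is an open condition, and grid points approximate the
    points of the minor when l is small. *)
Lemma has_minor_grid n : has_minor k X Y n ->
  \forall l \near 0^'+, has_minor k (grid l X) (grid l Y) n.
Proof.
move=> [x [y [Xx Yy /det_neq0_perturbC[e e0 eP]]]].
have [s s0 ks] := kc e0.
near=> l.
have /choice[x' x'P] i : exists x', grid l X x' /\ `|x i - x'| < s.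
  have [x' ? ?] : exists2 x', grid l X x' & `|x i - x'| < s; last by exists x'.
  move: i; near: l; apply: filter_forall => i; exact: grid_approx.
have /choice[y' y'P] i : exists y', grid l Y y' /\ `|y i - y'| < s.
  have [y' ? ?] : exists2 y', grid l Y y' & `|y i - y'| < s; last by exists y'.
  move: i; near: l; apply: filter_forall => i; exact: grid_approx.
exists x', y'; split=> [i|j|]; [by case: (x'P i)|by case: (y'P j)|].
apply: eP => i j; rewrite !mxE normcB.
have [[Xx' _] xx'] := x'P i; have [[Yy' _] yy'] := y'P j.
by apply/ltW/ks.
Unshelve. all: by end_near. Qed.

Lemma cvg_rank_discrete_op :
  rank (@discrete_op R d X Y l k) @[l --> 0^'+] -->
  rank (@kernel_op R d X Y k).
Proof.
apply: (cvg_dimension (V := fun l => (grid l X -> R[i]^o : lmodType R[i]))).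
  near=> l => n /indep_range_discrete_has_minor indn.
  apply: (has_minor_indep_range oX bX oY bY kc kM).
  apply: has_minorS (indn _ bY); last by near: l; exact: nbhs_right_gt.
  - by move=> x [].
  - by move=> y [].
move=> n /(indep_range_has_minor oX bX oY bY kc kM)/has_minor_grid.
apply: filter_app; near=> l; apply: has_minor_indep_range_discrete => //.
Unshelve. all: by end_near. Qed.

End rank_limit.

Lemma bounded_set_closure (R : realType) d (A : set 'rV[R]_d) :
  bounded_set A -> bounded_set (closure A).
Proof.
move=> [M [Mr AM]]; exists (M + 1); split=> [|N MN x clAx]; first exact: num_real.
have [y [Ay]] := clAx _ (nbhsx_ballx x _ ltr01).
rewrite -ball_normE /ball_/= => xy.
rewrite -[x](subrK y) (le_trans (ler_normD _ _))//.
have : `|y| <= N - 1 by apply: AM => //; rewrite ltrBrDr.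
lra.
Qed.

(** Covers correlation and convolution together: op stands for addition or
    subtraction. Being additive and bounded by the norms, it transports
    uniform continuity and boundedness from f to the kernel. *)
Lemma cvg_rank_convolution_type (R : realType) d (X Y : set 'rV[R]_d)
    (op : 'rV[R]_d -> 'rV[R]_d -> 'rV[R]_d) (f : 'rV[R]_d -> R[i]^o) :
  open X -> bounded_set X -> open Y -> bounded_set Y ->
  (forall x y, `|op x y| <= `|x| + `|y|) ->
  (forall x x' y y', op x y - op x' y' = op (x - x') (y - y')) ->
  {within closure [set op x y | x in X & y in Y], continuous f} ->
  rank (@discrete_op R d X Y l (fun x y => f (op x y)))
    @[l --> 0^'+] -->
  rank (@kernel_op R d X Y (fun x y => f (op x y))).
Proof.
move=> oX bX oY bY opD opB cf; set Omega := [set _ | _ in _ & _ in _] in cf.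
have cOmega x y : X x -> Y y -> closure Omega (op x y).
  by move=> Xx Yy; apply: subset_closure; exists x => //; exists y.
have cptO : compact (closure Omega).
  apply: bounded_closed_compact (@closed_closure _ _).
  apply: bounded_set_closure.
  have [M1 [M1r XM]] := bX; have [M2 [M2r YM]] := bY.
  exists ((`|M1| + 1) + (`|M2| + 1)); split=> [|N MN]; first exact: num_real.
  move=> _ [x Xx [y Yy <-]] /=.
  apply: le_trans (ltW MN); apply: (le_trans (opD x y)); apply: lerD.
    by apply: XM => //; rewrite (le_lt_trans (ler_norm M1))// ltrDl.
  by apply: YM => //; rewrite (le_lt_trans (ler_norm M2))// ltrDl.
have [M fM] := compact_normc_bounded cptO cf.
apply: (@cvg_rank_discrete_op _ _ _ _ oX bX oY bY _ M) => [e e0|x y Xx Yy]; last first.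
  exact/fM/cOmega.
have [r r0 fr] := compact_unif_continuous cptO cf e0.
exists (r / 2) => [|x x' y y' Xx Xx' Yy Yy' xx' yy']; first by rewrite divr_gt0.
apply: fr; [exact: cOmega|exact: cOmega|].
by rewrite opB (le_lt_trans (opD _ _))// (splitr r) ltrD.
Qed.

Theorem corollary6p5 (R : realType) (d : nat) (Y X : set 'rV[R]_d) :
  (0 < d)%N ->
  Y !=set0 -> open Y -> bounded_set Y -> connected Y ->
  X !=set0 -> open X -> bounded_set X -> connected X ->
  (forall f : 'rV[R]_d -> R[i]^o,
      {within closure [set x + y | x in X & y in Y], continuous f} ->
      rank (dcorr_op X Y f l) @[l --> 0^'+] --> rank (corr_op X Y f))
  /\
  (forall f : 'rV[R]_d -> R[i]^o,
      {within closure [set x - y | x in X & y in Y], continuous f} ->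
      rank (dconv_op X Y f l) @[l --> 0^'+] --> rank (conv_op X Y f)).
Proof.
move=> _ _ oY bY _ _ oX bX _; split=> f cf.
- apply: (cvg_rank_convolution_type (op := fun x y => x + y) oX bX oY bY) cf => //.
    exact: ler_normD.
  by move=> x x' y y'; rewrite opprD addrACA.
- apply: (cvg_rank_convolution_type (op := fun x y => x - y) oX bX oY bY) cf => //.
    exact: ler_normB.
  by move=> x x' y y'; rewrite !opprB [y' - x']addrC addrACA [- y + y']addrC.
Qed.
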